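(* Let $W\in\mathbb{R}^{p\times p}$, $p=m+n+1$, be the symmetric KKT matrix of an interpolation set, assume $W$ is nonsingular, and put $H=W^{-1}$. Let $\Delta W=e_kw^\top+we_k^\top$ be a symmetric rank-at-most-two perturbation on the $k$-th row and column, where $k\in\{1,\dots,p\}$, $e_k$ is the $k$-th standard basis vector of $\mathbb{R}^{p}$ and $w\in\mathbb{R}^{p}$. Define $$a=He_k,\quad b=Hw,\quad \alpha=e_k^\top a,\quad q=w^\top b,\quad \tau=e_k^\top b,\quad \delta_{\rm SMW}=(1+\tau)^2-\alpha q,$$ and assume $\delta_{\rm SMW}\neq0$. Then the updated inverse KKT matrix $\widehat H=(W+\Delta W)^{-1}$ is given by $$\widehat H=H+\frac1{\delta_{\rm SMW}}\Big[q\,aa^\top+\alpha\,bb^\top-(1+\tau)\big(ab^\top+ba^\top\big)\Big],$$ and, given $H$, $w$ and $k$, this formula is evaluated in $\mathcal{O}(n^2)$ arithmetic operations when $m=\mathcal{O}(n)$.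
   Context: For a base point $x_0\in\mathbb{R}^n$ and interpolation points $x_1,\dots,x_m\in\mathbb{R}^n$ with $n+2\le m\le\frac12(n+1)(n+2)$, the KKT matrix (of minimum Frobenius norm quadratic interpolation) is $$W=\begin{pmatrix}A & X^\top \\ X & 0\end{pmatrix}\in\mathbb{R}^{(m+n+1)\times(m+n+1)},\qquad A_{ij}=\tfrac12\langle x_i-x_0,x_j-x_0\rangle^2,$$ where $X\in\mathbb{R}^{(n+1)\times m}$ has $i$-th column $(1,(x_i-x_0)^\top)^\top$. *)

(* Defs.v *)
From HB Require Import structures.
From mathcomp Require Import all_boot all_order all_algebra.
From mathcomp Require Import reals.
Set Implicit Arguments.
Unset Strict Implicit.
Unset Printing Implicit Defensive.
Import Order.TTheory GRing.Theory Num.Theory.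
Local Open Scope ring_scope.

Definition dot (R : realType) (p : nat) (u v : 'cV[R]_p) : R :=
  (u^T *m v) 0 0.

Definition basis_vec (R : realType) (p : nat) (k : 'I_p) : 'cV[R]_p :=
  delta_mx k 0.

Definition kktA (R : realType) (n m : nat) (x0 : 'cV[R]_n)
    (x : 'I_m -> 'cV[R]_n) : 'M[R]_m :=
  \matrix_(i < m, j < m) (2^-1 * dot (x i - x0) (x j - x0) ^+ 2).

Definition kktX (R : realType) (n m : nat) (x0 : 'cV[R]_n)
    (x : 'I_m -> 'cV[R]_n) : 'M[R]_(1 + n, m) :=
  \matrix_(i < 1 + n, j < m) (col_mx (const_mx 1 : 'cV[R]_1) (x j - x0)) i 0.

Definition kkt (R : realType) (n m : nat) (x0 : 'cV[R]_n)
    (x : 'I_m -> 'cV[R]_n) : 'M[R]_(m + (1 + n)) :=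
  block_mx (kktA x0 x) (kktX x0 x)^T (kktX x0 x) 0.

Definition rowcol_update (R : realType) (p : nat) (k : 'I_p)
    (w : 'cV[R]_p) : 'M[R]_p :=
  basis_vec R k *m w^T + w *m (basis_vec R k)^T.

Definition smw_delta (R : realType) (p : nat) (H : 'M[R]_p) (k : 'I_p)
    (w : 'cV[R]_p) : R :=
  let a := H *m basis_vec R k in
  let b := H *m w in
  let alpha := dot (basis_vec R k) a in
  let q := dot w b in
  let tau := dot (basis_vec R k) b in
  (1 + tau) ^+ 2 - alpha * q.

Definition smw_formula (R : realType) (p : nat) (H : 'M[R]_p) (k : 'I_p)
    (w : 'cV[R]_p) : 'M[R]_p :=
  let a := H *m basis_vec R k in
  let b := H *m w in
  let alpha := dot (basis_vec R k) a in
  let q := dot w b in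
  let tau := dot (basis_vec R k) b in
  H + (smw_delta H k w)^-1 *:
    (q *: (a *m a^T) + alpha *: (b *m b^T)
     - (1 + tau) *: (a *m b^T + b *m a^T)).

(* Arithmetic cost is measured by straight-line programs.  A program is fixed
   before the values of its inputs are known (no branching on data), each
   instruction performs one arithmetic operation and appends its result to the
   register file; reading an input, an integer constant or a register is free. *)
Inductive operand (I : Type) : Type :=
  | Input of I
  | Const of int
  | Reg of nat.

Inductive arith_op : Type := OpAdd | OpSub | OpMul | OpDiv.

Record instr (I : Type) : Type :=
  Instr { iop : arith_op; iarg1 : operand I; iarg2 : operand I }.

Definition program (I : Type) : Type := seq (instr I).

Definition op_count (I : Type) (P : program I) : nat := size P.

(* [None] when the register has not been written yet. *)
Definition read (R : realType) (I : Type) (env : I -> R) (regs : seq R)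
    (o : operand I) : option R :=
  match o with
  | Input i => Some (env i)
  | Const z => Some z%:~R
  | Reg r => onth regs r
  end.

(* Division by zero is an error, unlike in the field [R] where [x / 0 = 0]. *)
Definition exec_op (R : realType) (op : arith_op) (u v : R) : option R :=
  match op with
  | OpAdd => Some (u + v)
  | OpSub => Some (u - v)
  | OpMul => Some (u * v)
  | OpDiv => if v == 0 then None else Some (u / v)
  end.

Definition step (R : realType) (I : Type) (env : I -> R) (regs : seq R)
    (c : instr I) : option (seq R) :=
  match read env regs (iarg1 c), read env regs (iarg2 c) with
  | Some u, Some v => omap (rcons regs) (exec_op (iop c) u v)
  | _, _ => None
  end.

Fixpoint run (R : realType) (I : Type) (env : I -> R) (regs : seq R)
    (P : program I) : option (seq R) :=
  match P with
  | [::] => Some regs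
  | c :: P' => obind (fun regs' => run env regs' P') (step env regs c)
  end.

Inductive smw_input (p : nat) : Type :=
  | EntryH of 'I_p & 'I_p
  | Entryw of 'I_p.

Definition smw_env (R : realType) (p : nat) (H : 'M[R]_p) (w : 'cV[R]_p)
    (i : smw_input p) : R :=
  match i with
  | EntryH r s => H r s
  | Entryw r => w r 0
  end.

(* [out r s] tells where the program leaves the [(r, s)] entry of its result. *)
Definition computes (R : realType) (p : nat) (P : program (smw_input p))
    (out : 'I_p -> 'I_p -> operand (smw_input p)) (H : 'M[R]_p)
    (w : 'cV[R]_p) (M : 'M[R]_p) : Prop :=
  exists2 regs : seq R, run (smw_env H w) [::] P = Some regs &
    forall r s : 'I_p, read (smw_env H w) regs (out r s) = Some (M r s).

(* Main.v *)
Require Import Defs.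
From mathcomp Require Import all_boot all_order all_algebra.
From mathcomp Require Import reals.
From mathcomp Require Import classical_sets ring zify.
Set Implicit Arguments.
Unset Strict Implicit.
Unset Printing Implicit Defensive.
Import Order.TTheory GRing.Theory Num.Theory.
Local Open Scope ring_scope.

(** The inverse formula comes from looking at the perturbed matrix
    [M = W + e w^T + w e^T] on the plane spanned by [a = H e] and [b = H w].
    Symmetry of [W] gives [w^T a = e^T b = tau], whence
      [M a = (1 + tau) e + alpha w]   and   [M b = q e + (1 + tau) w],
    a 2 x 2 system in [e], [w] whose determinant is
    [delta = (1 + tau)^2 - alpha q].  Inverting it,
      [M (q a - (1 + tau) b) = - delta w]  and
      [M (alpha b - (1 + tau) a) = - delta e].
    On the other hand [M H = 1 + e b^T + w a^T], so adding to [H] the matrix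
      [delta^-1 ((q a - (1 + tau) b) a^T + (alpha b - (1 + tau) a) b^T)]
    cancels exactly the two unwanted terms; this is [rowcol_update_mulmx].

    For the cost, with [p = m + n + 1], the column [a] is read off [H] for
    free, the product [b = H w] takes [2 p^2] operations and [q] takes [2 p];
    [1 / delta] takes a constant number, and each of the [p^2] entries of the
    result is then a fixed expression in quantities that are already available.
    Sharing the intermediate results is the whole point, so the bookkeeping is
    done with a relation [evaluable S c T]: whatever program already stores the
    quantities in [S], [c] further instructions make those of [T] available.
    It composes like the rules of a cost semantics with let-bindings, and the
    programs themselves never have to be written down.  Finally
    [n + 2 <= m <= (n + 1) (n + 2) / 2] excludes [n = 0], and [m <= c n] then
    gives [p <= (c + 2) n]. *)

(** * The rank-two update of a symmetric inverse *)

Lemma dotC (R : realType) (p : nat) (u v : 'cV[R]_p) : dot u v = dot v u.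
Proof.
by rewrite /dot !mxE; apply: eq_bigr => i _; rewrite !mxE mulrC.
Qed.

Lemma trmx_kkt (R : realType) (n m : nat) (x0 : 'cV[R]_n)
    (x : 'I_m -> 'cV[R]_n) : (kkt x0 x)^T = kkt x0 x.
Proof.
rewrite /kkt tr_block_mx trmxK trmx0; congr (block_mx _ _ _ _).
by apply/matrixP => i j; rewrite !mxE dotC.
Qed.

Lemma mulmx_outer (R : realType) (p : nat) (u v y : 'cV[R]_p) :
  (u *m v^T) *m y = dot v y *: u.
Proof. by rewrite -mulmxA [v^T *m y]mx11_scalar mul_mx_scalar. Qed.

(** The products [M a] and [M b] are combinations of [e] and [w] with
    coefficients [alpha], [q] and [1 + tau], so [M] maps the correction term to
    a combination of four outer products in which only [e b^T] and [w a^T]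
    survive, both with coefficient [- 1].  The symmetry of [W] enters through
    the row equations for [H] and through [dot w a = dot e b]. *)
Lemma rowcol_update_mulmx (R : realType) (p : nat) (W H : 'M[R]_p)
    (e w a b : 'cV[R]_p) :
  W *m H = 1%:M -> W *m a = e -> W *m b = w ->
  e^T *m H = a^T -> w^T *m H = b^T -> dot w a = dot e b ->
  let alpha := dot e a in let q := dot w b in let tau := dot e b in
  let delta := (1 + tau) ^+ 2 - alpha * q in
  delta != 0 ->
  (W + (e *m w^T + w *m e^T)) *m
    (H + delta^-1 *: (q *: (a *m a^T) + alpha *: (b *m b^T)
                      - (1 + tau) *: (a *m b^T + b *m a^T))) = 1%:M.
Proof.
move=> WH Wa Wb eH wH wa_eb alpha q tau delta delta0.
set M := W + _.
have Ma : M *m a = (1 + tau) *: e + alpha *: w.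
  by rewrite !mulmxDl Wa !mulmx_outer wa_eb addrA scalerDl scale1r.
have Mb : M *m b = q *: e + (1 + tau) *: w.
  by rewrite !mulmxDl Wb !mulmx_outer scalerDl scale1r addrCA.
have MH : M *m H = 1%:M + (e *m b^T + w *m a^T).
  by rewrite !mulmxDl WH -!mulmxA eH wH.
rewrite mulmxDr MH -scalemxAr mulmxBr mulmxDr -!scalemxAr mulmxDr !mulmxA Ma Mb.
rewrite !mulmxDl -!scalemxAl.
(* What remains is linear in the four outer products. *)
move: (e *m a^T) (e *m b^T) (w *m a^T) (w *m b^T) => ea eb wa wb.
apply/matrixP => i j; rewrite !mxE.
by move: delta0; rewrite /delta => delta0; field.
Qed.

Lemma invmx_rowcol_update (R : realType) (p : nat) (W : 'M[R]_p) (k : 'I_p)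
    (w : 'cV[R]_p) :
  W^T = W -> W \in unitmx -> smw_delta (invmx W) k w != 0 ->
  W + rowcol_update k w \in unitmx /\
  invmx (W + rowcol_update k w) = smw_formula (invmx W) k w.
Proof.
move=> Wsym Wunit delta0; set H := invmx W.
have Hsym : H^T = H by rewrite trmx_inv Wsym.
have trH (u : 'cV[R]_p) : u^T *m H = (H *m u)^T by rewrite trmx_mul Hsym.
have wa_eb : dot w (H *m basis_vec R k) = dot (basis_vec R k) (H *m w).
  by rewrite [LHS]dotC /dot -trH -mulmxA.
have MK : (W + rowcol_update k w) *m smw_formula H k w = 1%:M.
  by apply: rowcol_update_mulmx; rewrite ?mulmxV ?mulKVmx ?trH.
have [Munit _] := mulmx1_unit MK.
by split=> //; rewrite -[RHS](mulKmx Munit) MK mulmx1.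
Qed.

(** * Counting instructions of straight-line programs *)

Section StraightLine.
Local Open Scope classical_set_scope.
Context {R : realType} {I X : Type} (env : X -> I -> R).
Implicit Types (P Q : program I) (f g h : X -> R) (S T U : set (X -> R)).

Lemma run_cat (e : I -> R) regs P Q :
  run e regs (P ++ Q) = obind (fun regs' => run e regs' Q) (run e regs P).
Proof. by elim: P regs => //= i P IH regs; case: step => //= regs'. Qed.

Lemma step_rcons (e : I -> R) regs i regs' :
  step e regs i = Some regs' -> exists v, regs' = rcons regs v.
Proof.
rewrite /step; case: read => // u; case: read => // v.
by case: exec_op => //= y [<-]; exists y.
Qed.

Lemma run_extends (e : I -> R) regs P regs' :
  run e regs P = Some regs' ->
  exists2 new, size new = size P & regs' = regs ++ new.
Proof.
elim: P regs => [|i P IH] regs /=; first by case=> <-; exists [::]; rewrite ?cats0.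
case E: step => [regs1|] //= /IH [new <- ->].
by have [v ->] := step_rcons E; exists (v :: new); rewrite // cat_rcons.
Qed.

Lemma read_cat (e : I -> R) regs new o v :
  read e regs o = Some v -> read e (regs ++ new) o = Some v.
Proof.
case: o => //= r; rewrite onth_cat; case: ltnP => // le_r.
by rewrite onth_default.
Qed.

(** The operand is chosen before the data [x]: the location of a result may not
    depend on the values of the inputs. *)
Definition stored P : set (X -> R) := [set f | exists o, forall x,
  exists2 regs, run (env x) [::] P = Some regs &
                read (env x) regs o = Some (f x)].

Definition runs P : Prop := forall x, run (env x) [::] P.

(** Quantifying over all programs that store [S], instead of naming one, is what
    lets evaluations be chained without tracking register numbers. *)
Definition evaluable S (c : nat) T : Prop :=
  forall P, runs P -> S `<=` stored P ->
  exists Q, [/\ (size Q <= c)%N, runs (P ++ Q) & T `<=` stored (P ++ Q)].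

Lemma stored_cat P Q : runs (P ++ Q) -> stored P `<=` stored (P ++ Q).
Proof.
move=> runPQ f [o fo]; exists o => x; have [regs rP ro] := fo x.
have := runPQ x; case E: run => [regs'|] // _; exists regs' => //.
by move: E; rewrite run_cat rP => /run_extends[new _ ->]; apply: read_cat.
Qed.

Lemma evaluable_mono S S' c c' T T' :
  S `<=` S' -> (c <= c')%N -> T' `<=` T ->
  evaluable S c T -> evaluable S' c' T'.
Proof.
move=> SS' cc' TT' ev P runP S'P.
have [Q [sQ rQ tQ]] := ev P runP (subset_trans SS' S'P).
by exists Q; split; [apply: leq_trans cc' | | apply: subset_trans tQ].
Qed.

(** The rule for let-bindings: results of the first stage are paid for once
    and may be used any number of times in the second. *)
Lemma evaluable_let S c T d U :
  evaluable S c T -> evaluable (S `|` T) d U -> evaluable S (c + d) (T `|` U).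
Proof.
move=> evT evU P runP SP; have [Q [sQ rQ tQ]] := evT P runP SP.
have ST : S `|` T `<=` stored (P ++ Q).
  by rewrite subUset; split=> //; apply: subset_trans SP (stored_cat rQ).
have [Q' [sQ' rQ' uQ']] := evU _ rQ ST.
exists (Q ++ Q'); rewrite catA size_cat; split=> //; first exact: leq_add.
by rewrite subUset; split=> //; apply: subset_trans tQ (stored_cat rQ').
Qed.

Lemma evaluableU S c T d U :
  evaluable S c T -> evaluable S d U -> evaluable S (c + d) (T `|` U).
Proof.
move=> evT evU; apply: evaluable_let evT _.
by apply: evaluable_mono evU => //; apply: subsetUl.
Qed.

Lemma evaluable_free S f :
  (forall P, runs P -> S `<=` stored P -> stored P f) -> evaluable S 0 [set f].
Proof.
move=> Pf P runP SP; exists [::]; rewrite cats0; split=> // _ ->.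
exact: Pf.
Qed.

Lemma evaluable_known S f : S f -> evaluable S 0 [set f].
Proof. by move=> Sf; apply: evaluable_free => P _; apply. Qed.

Lemma evaluable_input S i : evaluable S 0 [set (fun x => env x i)].
Proof.
apply: evaluable_free => P runP _; exists (Input i) => x.
by have := runP x; case: run => // regs _; exists regs.
Qed.

Lemma evaluable_const S (z : int) : evaluable S 0 [set (fun=> z%:~R)].
Proof.
apply: evaluable_free => P runP _; exists (Const I z) => x.
by have := runP x; case: run => // regs _; exists regs.
Qed.

Lemma evaluable_op S op c f d g h :
  (forall x, exec_op op (f x) (g x) = Some (h x)) ->
  evaluable S c [set f] -> evaluable S d [set g] ->
  evaluable S (c + d).+1 [set h].
Proof.
move=> fgh evf evg P runP SP.
have [Q [sQ rQ fgQ]] := evaluableU evf evg runP SP.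
have [of_ fQ] := fgQ f (or_introl erefl).
have [og gQ] := fgQ g (or_intror erefl).
have run1 x : exists2 regs, run (env x) [::] (P ++ rcons Q (Instr op of_ og))
    = Some (rcons regs (h x)) & size regs = size (P ++ Q).
  have [regs rPQ rf] := fQ x; have := gQ x; rewrite rPQ => -[_ [<-] rg].
  exists regs; last by have [new <- ->] := run_extends rPQ.
  by rewrite -rcons_cat -cats1 run_cat rPQ /= /step rf rg /= fgh.
exists (rcons Q (Instr op of_ og)); split; first by rewrite size_rcons.
  by move=> x; have [regs ->] := run1 x.
move=> _ ->; exists (Reg I (size (P ++ Q))) => x.
have [regs rQ' <-] := run1 x; eexists; first exact: rQ'.
by rewrite /= -cats1 onth_cat ltnn subnn.
Qed.

Lemma evaluableD S c f d g :
  evaluable S c [set f] -> evaluable S d [set g] ->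
  evaluable S (c + d).+1 [set (fun x => f x + g x)].
Proof. exact: (@evaluable_op _ OpAdd). Qed.

Lemma evaluableB S c f d g :
  evaluable S c [set f] -> evaluable S d [set g] ->
  evaluable S (c + d).+1 [set (fun x => f x - g x)].
Proof. exact: (@evaluable_op _ OpSub). Qed.

Lemma evaluableM S c f d g :
  evaluable S c [set f] -> evaluable S d [set g] ->
  evaluable S (c + d).+1 [set (fun x => f x * g x)].
Proof. exact: (@evaluable_op _ OpMul). Qed.

Lemma evaluable_div S c f d g :
  (forall x, g x != 0) ->
  evaluable S c [set f] -> evaluable S d [set g] ->
  evaluable S (c + d).+1 [set (fun x => f x / g x)].
Proof. by move=> g0; apply: (@evaluable_op _ OpDiv) => x /=; rewrite ifN. Qed.

Lemma evaluable_ext S c f g :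
  f =1 g -> evaluable S c [set f] -> evaluable S c [set g].
Proof. by move=> /boolp.funext ->. Qed.

Lemma evaluable_sum S c (n : nat) (F : 'I_n -> X -> R) :
  (forall i, evaluable S c [set F i]) ->
  evaluable S (n * c.+1) [set (fun x => \sum_i F i x)].
Proof.
elim: n F => [|n IH] F evF.
  by apply: (evaluable_ext _ (evaluable_const 0)) => x; rewrite big_ord0.
apply: (@evaluable_ext _ _
  (fun x => \sum_i F (widen_ord (leqnSn n) i) x + F ord_max x)).
  by move=> x; rewrite big_ord_recr.
by rewrite mulSn addnC addnS; apply: evaluableD => //; apply: IH.
Qed.

Lemma evaluable_family S c (J : finType) (F : J -> X -> R) :
  (forall j, evaluable S c [set F j]) -> evaluable S (#|J| * c) (range F).
Proof.
move=> evF; suff ev s : evaluable S (size s * c) [set F j | j in [set` s]].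
  rewrite cardT; apply: evaluable_mono (ev (enum J)) => // _ [j _ <-].
  by exists j; rewrite //= mem_enum.
elim: s => [|j s IH].
  by move=> P runP _; exists [::]; rewrite cats0; split=> // f [].
apply: evaluable_mono (evaluableU (evF j) IH) => //.
by move=> _ [i /= /predU1P[->|si] <-]; [left | right; exists i].
Qed.

(** Since the data range over the type [X], a program that is only required to
    succeed on admissible data is obtained by taking for [X] the type of
    admissible data. *)
Lemma evaluable_program c (J : finType) (F : J -> X -> R) :
  evaluable set0 c (range F) ->
  exists (P : program I) (out : J -> operand I), (op_count P <= c)%N /\
    forall x, exists2 regs, run (env x) [::] P = Some regs &
      forall j, read (env x) regs (out j) = Some (F j x).
Proof.
move=> ev; have [//|_ []|P [sP runP FP]] := ev [::] => //.
have [out outP] := fin_all_exists (fun j => FP (F j) (imageT F j)).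
exists P, out; split=> // x.
have := runP x; case E: run => [regs|] // _; exists regs => // j.
by have [regs' +] := outP j x; rewrite /= in E *; rewrite E => -[<-].
Qed.

End StraightLine.

(** * Cost of the update formula *)

Lemma dot_basis_vecl (R : realType) (p : nat) (k : 'I_p) (u : 'cV[R]_p) :
  dot (basis_vec R k) u = u k 0.
Proof. by rewrite /dot /basis_vec trmx_delta -rowE mxE. Qed.

Lemma mulmx_basis_vec (R : realType) (p : nat) (H : 'M[R]_p) (k r : 'I_p) :
  (H *m basis_vec R k) r 0 = H r k.
Proof. by rewrite /basis_vec -colE mxE. Qed.

Lemma mulmx_outerE (R : realType) (p : nat) (u v : 'cV[R]_p) (r s : 'I_p) :
  (u *m v^T) r s = u r 0 * v s 0.
Proof. by rewrite mxE big_ord1 mxE. Qed.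

Local Open Scope classical_set_scope.

(** The bound is the total of [2 p^2] for [b], [2 p] for [q], [6] for
    [1 / delta] and [13] for each entry of the result, rounded up using
    [0 < p], which holds because [k] exists. *)
Lemma smw_program (R : realType) (p : nat) (k : 'I_p) :
  exists (P : program (smw_input p))
      (out : 'I_p -> 'I_p -> operand (smw_input p)),
    (op_count P <= 23 * p ^ 2)%N /\
    forall (H : 'M[R]_p) (w : 'cV[R]_p), smw_delta H k w != 0 ->
      computes P out H w (smw_formula H k w).
Proof.
(* Only data with [delta != 0] are considered, so the division is defined. *)
pose X := {Hw : 'M[R]_p * 'cV[R]_p | smw_delta Hw.1 k Hw.2 != 0}.
pose env (x : X) := smw_env (sval x).1 (sval x).2.
pose b r x := \sum_s env x (EntryH r s) * env x (Entryw s).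
pose q x := \sum_s env x (Entryw s) * b s x.
pose alpha x := env x (EntryH k k).
pose tau1 x := 1%:~R + b k x.
pose delta x := tau1 x * tau1 x - alpha x * q x.
pose dinv x := 1%:~R / delta x.
pose F (rs : 'I_p * 'I_p) x := env x (EntryH rs.1 rs.2) + dinv x *
  (q x * (env x (EntryH rs.1 k) * env x (EntryH rs.2 k))
   + alpha x * (b rs.1 x * b rs.2 x)
   - tau1 x * (env x (EntryH rs.1 k) * b rs.2 x
               + b rs.1 x * env x (EntryH rs.2 k))).
have bE x r : b r x = ((sval x).1 *m (sval x).2) r 0 by rewrite mxE.
have qE x : q x = dot (sval x).2 ((sval x).1 *m (sval x).2).
  by rewrite /dot mxE; apply: eq_bigr => s _; rewrite mxE bE.
have deltaE x : delta x = smw_delta (sval x).1 k (sval x).2.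
  by rewrite /smw_delta !dot_basis_vecl mulmx_basis_vec -bE -qE expr2.
have delta0 x : delta x != 0 by rewrite deltaE; case: x.
have entryE (M A B C D : 'M[R]_p) (d y z t : R) r s :
    (M + d *: (y *: A + z *: B - t *: (C + D))) r s =
    M r s + d * (y * A r s + z * B r s - t * (C r s + D r s)).
  by rewrite !mxE.
have FE x r s : F (r, s) x = smw_formula (sval x).1 k (sval x).2 r s.
  rewrite /F /dinv deltaE div1r /smw_formula !dot_basis_vecl mulmx_basis_vec.
  by rewrite entryE !mulmx_outerE !mulmx_basis_vec -!bE -qE.
(* [K1], [K2], [K3] collect the results known after each stage. *)
pose K1 := range b; pose K2 := K1 `|` [set q]; pose K3 := K2 `|` [set dinv].
have evi S i : evaluable env S 0 [set env^~ i] by exact: evaluable_input.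
have ev1 : evaluable env set0 (p * (p * 2)) K1.
  have -> : (p * (p * 2) = #|'I_p| * (p * 2))%N by rewrite card_ord.
  apply: evaluable_family => r; apply: evaluable_sum => s.
  exact: (evaluableM (evi _ (EntryH r s)) (evi _ (Entryw s))).
have ev2 : evaluable env set0 (p * (p * 2) + p * 2) K2.
  apply: evaluable_let ev1 _; rewrite set0U; apply: evaluable_sum => s.
  apply: (evaluableM (evi _ (Entryw s))).
  by apply: evaluable_known; exists s.
have ev3 : evaluable env set0 (p * (p * 2) + p * 2 + 6) K3.
  apply: evaluable_let ev2 _; rewrite set0U.
  have evtau1 : evaluable env K2 1 [set tau1].
    apply: (evaluableD (evaluable_const 1)).
    by apply: evaluable_known; left; exists k.
  apply: (evaluable_div delta0 (evaluable_const 1)).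
  apply: (evaluableB (evaluableM evtau1 evtau1)).
  apply: (evaluableM (evi _ (EntryH k k))).
  by apply: evaluable_known; right.
have ev4 : evaluable env K3 (p * p * 13) (range F).
  have -> : (p * p * 13 = #|{: 'I_p * 'I_p}| * 13)%N.
    by rewrite card_prod card_ord.
  apply: evaluable_family => -[r s].
  have evbr t : evaluable env K3 0 [set b t].
    by apply: evaluable_known; left; left; exists t.
  have evq : evaluable env K3 0 [set q] by apply: evaluable_known; left; right.
  have evdinv : evaluable env K3 0 [set dinv] by apply: evaluable_known; right.
  have evtau1 : evaluable env K3 1 [set tau1].
    exact: (evaluableD (evaluable_const 1) (evbr k)).
  have evqaa := evaluableM evq
    (evaluableM (evi _ (EntryH r k)) (evi _ (EntryH s k))).
  have evabb := evaluableM (evi _ (EntryH k k)) (evaluableM (evbr r) (evbr s)).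
  have evcross := evaluableM evtau1 (evaluableD
    (evaluableM (evi _ (EntryH r k)) (evbr s))
    (evaluableM (evbr r) (evi _ (EntryH s k)))).
  exact: (evaluableD (evi _ (EntryH r s))
    (evaluableM evdinv (evaluableB (evaluableD evqaa evabb) evcross))).
have evF : evaluable env set0 (23 * p ^ 2) (range F).
  rewrite -(set0U K3) in ev4.
  apply: evaluable_mono (evaluable_let ev3 ev4) => //.
  have p_gt0 : (0 < p)%N by apply: leq_ltn_trans (ltn_ord k).
  by rewrite -mulnn; nia.
have [P [out [sizeP outP]]] := evaluable_program evF.
exists P, (fun r s => out (r, s)); split=> // H w Hw.
have [regs runP readP] := outP (exist _ (H, w) Hw).
by exists regs => // r s; rewrite readP FE.
Qed.

Local Close Scope classical_set_scope.

Theorem theorem2p1 (R : realType) :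
  (forall (n m : nat) (x0 : 'cV[R]_n) (x : 'I_m -> 'cV[R]_n)
      (k : 'I_(m + (1 + n))) (w : 'cV[R]_(m + (1 + n))),
    (n + 2 <= m <= ((n + 1) * (n + 2)) %/ 2)%N ->
    let W := kkt x0 x in
    W \in unitmx ->
    let H := invmx W in
    let a := H *m basis_vec R k in
    let b := H *m w in
    let alpha := dot (basis_vec R k) a in
    let q := dot w b in
    let tau := dot (basis_vec R k) b in
    let delta := (1 + tau) ^+ 2 - alpha * q in
    delta != 0 ->
    W + rowcol_update k w \in unitmx /\
    invmx (W + rowcol_update k w) =
      H + delta^-1 *: (q *: (a *m a^T) + alpha *: (b *m b^T)
                       - (1 + tau) *: (a *m b^T + b *m a^T)))
  /\
  (forall c : nat, exists C : nat, forall (n m : nat) (k : 'I_(m + (1 + n))),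
    (n + 2 <= m <= ((n + 1) * (n + 2)) %/ 2)%N ->
    (m <= c * n)%N ->
    exists (P : program (smw_input (m + (1 + n))))
      (out : 'I_(m + (1 + n)) -> 'I_(m + (1 + n)) ->
             operand (smw_input (m + (1 + n)))),
      (op_count P <= C * n ^ 2)%N /\
      forall (x0 : 'cV[R]_n) (x : 'I_m -> 'cV[R]_n)
        (w : 'cV[R]_(m + (1 + n))),
        kkt x0 x \in unitmx ->
        let H := invmx (kkt x0 x) in
        smw_delta H k w != 0 ->
        computes P out H w (smw_formula H k w)).
Proof.
split=> [n m x0 x k w _ W Wunit H a b alpha q tau delta delta0 | c].
  exact: invmx_rowcol_update (trmx_kkt x0 x) Wunit delta0.
exists (23 * (c + 2) ^ 2)%N => n m k /andP[n2m m_le] m_cn.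
have [P [out [sizeP outP]]] := smw_program R k.
exists P, out; split=> [|x0 x w _ H]; last exact: outP.
apply: leq_trans sizeP _; rewrite -mulnA -expnMn leq_pmul2l // leq_exp2r //.
case: n => [|n] in k n2m m_le m_cn P out outP *; last by lia.
by have := leq_trans n2m m_le.
Qed.
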